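(* $\mathsf{MS4.t}$ is canonical; that is, if $\mathfrak B$ is an $\mathsf{MS4.t}$-algebra, then $(\mathfrak B_+)^+$ is an $\mathsf{MS4.t}$-algebra.
   Context: An interior operator on a boolean algebra $B$ is a map $\mathsf i:B\to B$ with $\mathsf i(a\wedge b)=\mathsf ia\wedge\mathsf ib$, $\mathsf i1=1$, $\mathsf ia\le a$, $\mathsf ia\le\mathsf{ii}a$. An $\mathsf{MS4.t}$-algebra is a tuple $\mathfrak B=(B,\Box_F,\Box_P,\forall)$ where $B$ is a boolean algebra, $\Box_F,\Box_P,\forall$ are interior operators on $B$, and, writing $\Diamond_F=\neg\Box_F\neg$, $\Diamond_P=\neg\Box_P\neg$, $\exists=\neg\forall\neg$, for all $a\in B$: $a\le\Box_P\Diamond_F a$, $a\le\Box_F\Diamond_P a$, $a\le\forall\exists a$, and $\Box_F\forall a\le\forall\Box_F a$. The canonical frame of $\mathfrak B$ is $\mathfrak B_+=(X_{\mathfrak B},R_{\mathfrak B},E_{\mathfrak B})$, where $X_{\mathfrak B}$ is the set of ultrafilters of $B$; $xR_{\mathfrak B}y$ iff $x\cap H_F\subseteq y$, with $H_F=\{a\mid\Box_F a=a\}$ (equivalently $y\cap H_P\subseteq x$, with $H_P=\{a\mid\Box_P a=a\}$); and $xE_{\mathfrak B}y$ iff $x\cap B_0=y\cap B_0$, with $B_0=\{a\mid\forall a=a\}$. For a frame $\mathfrak F=(X,R,E)$ with $R$ a quasi-order and $E$ an equivalence relation on $X$, $\mathfrak F^+=(\wp(X),\Box_R,\Box_{R^{\smile}},\forall_E)$,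 where $\Box_R(U)=X\setminus R^{-1}[X\setminus U]$, $\Box_{R^{\smile}}(U)=X\setminus R[X\setminus U]$, $\forall_E(U)=X\setminus E[X\setminus U]$; here $S^{-1}[U]=\{x\mid xSu\text{ for some }u\in U\}$ and $S[U]=\{x\mid uSx\text{ for some }u\in U\}$. *)

(* Defs.v *)
From Corelib Require Export RelationClasses.
From mathcomp Require Export all_boot all_order.
From mathcomp Require Export boolp classical_sets.

Set Implicit Arguments.
Unset Strict Implicit.
Unset Printing Implicit Defensive.

Import Order.TTheory.

(** Boolean algebras are MathComp's [ctbDistrLatticeType]s (complemented
    distributive lattices with bottom and top); the one-element algebra, in
    which [\bot = \top], is allowed. *)

Section BooleanAlgebra.
Local Open Scope order_scope.
Context {d : Order.disp_t} {B : ctbDistrLatticeType d}.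

Record interior_operator (i : B -> B) : Prop := {
  interior_meet : forall a b, i (a `&` b) = i a `&` i b;
  interior_top : i \top = \top;
  interior_le : forall a, i a <= a;
  interior_le_idem : forall a, i a <= i (i a)
}.

Definition dual_operator (f : B -> B) (a : B) : B := ~` f (~` a).

Record proper_filter (F : set B) : Prop := {
  pfilter_top : F \top;
  pfilter_meet : forall a b, F a -> F b -> F (a `&` b);
  pfilter_up : forall a b, a <= b -> F a -> F b;
  pfilter_bot : ~ F \bot
}.

Record ultrafilter (F : set B) : Prop := {
  ultra_filter : proper_filter F;
  ultra_max : forall G : set B, proper_filter G -> (F `<=` G)%classic -> G = F
}.

Definition fixed_points (f : B -> B) : set B := [set a | f a = a]%classic.

End BooleanAlgebra.

(** The signature of MS4.t-algebras, without the axioms. *)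
Record trimodal_algebra := TrimodalAlgebra {
  alg_disp : Order.disp_t;
  alg_sort :> ctbDistrLatticeType alg_disp;
  boxF : alg_sort -> alg_sort;
  boxP : alg_sort -> alg_sort;
  univ_op : alg_sort -> alg_sort
}.

Arguments boxF {_} _.
Arguments boxP {_} _.
Arguments univ_op {_} _.

Section Diamonds.
Context {B : trimodal_algebra}.
Definition diaF : B -> B := dual_operator boxF.
Definition diaP : B -> B := dual_operator boxP.
Definition exist_op : B -> B := dual_operator univ_op.
End Diamonds.

Record MS4t_algebra (B : trimodal_algebra) : Prop := {
  boxF_interior : interior_operator (@boxF B);
  boxP_interior : interior_operator (@boxP B);
  univ_interior : interior_operator (@univ_op B);
  le_boxP_diaF : forall a : B, (a <= boxP (diaF a))%O;
  le_boxF_diaP : forall a : B, (a <= boxF (diaP a))%O;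
  le_univ_exist : forall a : B, (a <= univ_op (exist_op a))%O;
  boxF_univ_op_le : forall a : B, (boxF (univ_op a) <= univ_op (boxF a))%O
}.

Record frame := Frame {
  world :> Type;
  accR : world -> world -> Prop;
  accE : world -> world -> Prop;
  accR_preorder : PreOrder accR;
  accE_equivalence : Equivalence accE
}.

Section ComplexAlgebra.
Local Open Scope classical_set_scope.

Definition rel_preimage {X : Type} (S : X -> X -> Prop) (U : set X) : set X :=
  [set x | exists2 u, U u & S x u].

Definition rel_image {X : Type} (S : X -> X -> Prop) (U : set X) : set X :=
  [set x | exists2 u, U u & S u x].

(** The boolean algebra structure on [set F] is the library's, ordered by
    inclusion. *)
Definition complex_algebra (F : frame) : trimodal_algebra :=
  @TrimodalAlgebra _ (set F)
    (fun U => ~` rel_preimage (@accR F) (~` U))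
    (fun U => ~` rel_image (@accR F) (~` U))
    (fun U => ~` rel_image (@accE F) (~` U)).

End ComplexAlgebra.

Section CanonicalFrame.
Local Open Scope classical_set_scope.
Variable B : trimodal_algebra.

Definition ultrafilters : Type := {x : set B | ultrafilter x}.

Definition canonical_R (x y : ultrafilters) : Prop :=
  sval x `&` fixed_points boxF `<=` sval y.

Definition canonical_E (x y : ultrafilters) : Prop :=
  sval x `&` fixed_points univ_op = sval y `&` fixed_points univ_op.

Lemma canonical_R_preorder : PreOrder canonical_R.
Proof.
split; first by move=> x a [].
by move=> x y z xy yz a [xa Ha]; apply: yz; split=> //; apply: xy.
Qed.

Lemma canonical_E_equivalence : Equivalence canonical_E.
Proof. by split=> [x|x y xy|x y z xy yz]; rewrite /canonical_E ?xy. Qed.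

Definition canonical_frame : frame :=
  Frame canonical_R_preorder canonical_E_equivalence.

End CanonicalFrame.

(* Main.v *)
Require Import Defs.

Set Implicit Arguments.
Unset Strict Implicit.
Unset Printing Implicit Defensive.

Import Order.Theory.

(** The three interior operators of a complex algebra come from a preorder, its
    converse and an equivalence relation, so every axiom but
    [boxF_univ_op_le] holds over any frame. That last axiom holds as soon as
    [E] followed by [R] is contained in [R] followed by [E]
    ([complex_algebra_MS4t]).

    For the canonical frame, take ultrafilters with [x E y] and [y R z]. An
    ultrafilter [w] with [x R w] and [w E z] is obtained by extending
    [(x `&` H_F) `|` (z `&` B_0)]. This set generates a proper filter: if
    [a] in [x `&` H_F] and [b] in [z `&` B_0] were disjoint, then
    [a <= ~` b] with [~` b] in [B_0], so that
    [a = boxF a <= boxF (univ_op (~` b)) <= univ_op (boxF (~` b))]; this last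
    element is in [x], hence in [y] since it is fixed by [univ_op], hence
    [boxF (~` b)] is in [y], and so in [z], and [z] would contain both [b] and
    [~` b]. Finally [z `&` B_0 `<=` w] gives [w E z], because [B_0] is closed
    under complement and ultrafilters decide every element. *)

(** * Ultrafilters of a boolean algebra *)

Section Ultrafilters.
Local Open Scope order_scope.
Context {d : Order.disp_t} {B : ctbDistrLatticeType d}.
Implicit Types (a b c : B) (F G S T x : set B).

(** Closure under finite meets, the empty one included. *)
Record meet_closed S : Prop := {
  meet_closed_top : S \top;
  meet_closed_meet : forall a b, S a -> S b -> S (a `&` b)
}.

Lemma pfilter_meet_closed F : proper_filter F -> meet_closed F.
Proof. by case. Qed.

Lemma upset_meet_closed a : meet_closed [set b | (a <= b)%O]%classic.
Proof.
split=> [|b c]; first exact: lex1.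
by rewrite /= lexI => -> ->.
Qed.

(** The filter generated by two sets, when these are closed under meets. *)
Definition filter_join S T : set B :=
  [set c | exists a b, [/\ S a, T b & (a `&` b <= c)%O]]%classic.

Lemma sub_filter_joinl S T : meet_closed T -> (S `<=` filter_join S T)%classic.
Proof. by move=> [T1 _] a Sa; exists a, \top; rewrite meetx1. Qed.

Lemma sub_filter_joinr S T : meet_closed S -> (T `<=` filter_join S T)%classic.
Proof. by move=> [S1 _] b Tb; exists \top, b; rewrite meet1x. Qed.

Lemma proper_filter_join S T : meet_closed S -> meet_closed T ->
    (forall a b, S a -> T b -> a `&` b <> \bot) ->
  proper_filter (filter_join S T).
Proof.
move=> [S1 SI] [T1 TI] ST; split.
- by exists \top, \top; rewrite meetx1.
- move=> c c' [a [b [Sa Tb abc]]] [a' [b' [Sa' Tb' abc']]].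
  exists (a `&` a'), (b `&` b'); split; [exact: SI | exact: TI |].
  by rewrite meetACA leI2.
- move=> c c' cc' [a [b [Sa Tb abc]]].
  by exists a, b; split=> //; apply: le_trans cc'.
- by case=> a [b [Sa Tb]]; rewrite lex0 => /eqP; apply: ST.
Qed.

Lemma ultrafilter_extension F : proper_filter F ->
  exists2 x, ultrafilter x & (F `<=` x)%classic.
Proof.
move=> pF.
(* The union with [F] lets the empty chain be bounded by [F] itself. *)
pose P G := proper_filter (F `|` G)%classic.
have [C CP Ctot|A [PA maxA]] := @Zorn_bigcup _ P.
  split.
  - by left; apply: pfilter_top.
  - move=> a b [Fa|[G CG Ga]] [Fb|[H CH Hb]].
    + by left; apply: pfilter_meet.
    + have [Fab|Hab] : (F `|` H)%classic (a `&` b).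
        by apply: (pfilter_meet (CP _ CH)); [left | right].
      * by left.
      * by right; exists H.
    + have [Fab|Gab] : (F `|` G)%classic (a `&` b).
        by apply: (pfilter_meet (CP _ CG)); [right | left].
      * by left.
      * by right; exists G.
    + have [K [CK Ka Kb]] : exists K, [/\ C K, K a & K b].
        have [GH|HG] := Ctot _ _ CG CH.
          by exists H; split=> //; exact: GH.
        by exists G; split=> //; exact: HG.
      have [Fab|Kab] : (F `|` K)%classic (a `&` b).
        by apply: (pfilter_meet (CP _ CK)); right.
      * by left.
      * by right; exists K.
  - move=> a b ab [Fa|[G CG Ga]].
      by left; apply: pfilter_up Fa.
    have [Fb|Gb] := pfilter_up (CP _ CG) ab (or_intror Ga).
      by left.
    by right; exists G.
  - case=> [|[G CG G0]]; first exact: pfilter_bot pF.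
    by apply: (pfilter_bot (CP _ CG)); right.
exists (F `|` A)%classic; last exact: subsetUl.
split=> // G pG FAG.
have FG : (F `|` G = G)%classic.
  by apply/setUidPr; apply: subset_trans FAG; apply: subsetUl.
have AG : (A `<=` G)%classic.
  by apply: subset_trans FAG; apply: subsetUr.
have GA : (G `<=` A)%classic.
  apply: contrapT => nGA; apply: (maxA G); first by split.
  by rewrite /P FG.
by apply/seteqP; split=> // a /GA; right.
Qed.

(** If [~` a] is not in [x], the filter generated by [x] and [a] is proper, so
    it is [x] by maximality. *)
Lemma ultrafilter_compl x a : ultrafilter x -> x a \/ x (~` a).
Proof.
move=> [px maxx].
have mx := pfilter_meet_closed px; have ma := upset_meet_closed a.
have [[b [c [xb /= ac bc0]]]|nbot] :=
    pselect (exists b c, [/\ x b, a <= c & b `&` c = \bot]).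
  right; apply: pfilter_up xb => //; rewrite -disj_leC.
  by rewrite -lex0 -bc0 leI2.
left; rewrite -(maxx (filter_join x [set b | (a <= b)%O]%classic)).
- by apply: sub_filter_joinr => //=.
- by apply: proper_filter_join => // b c xb ac bc; apply: nbot; exists b, c.
- exact: sub_filter_joinl.
Qed.

Lemma ultrafilter_not_compl x a : ultrafilter x -> x a -> ~ x (~` a).
Proof.
move=> [px _] xa xna; apply: (pfilter_bot px).
by rewrite -(meetxC a); apply: pfilter_meet.
Qed.

End Ultrafilters.

(** * Interior operators *)

Section InteriorOperators.
Local Open Scope order_scope.
Context {d : Order.disp_t} {B : ctbDistrLatticeType d} (i : B -> B).
Hypothesis int_i : interior_operator i.

Lemma interior_idem a : i (i a) = i a.
Proof.
by apply/le_anti; rewrite (interior_le int_i) (interior_le_idem int_i).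
Qed.

Lemma interior_mono a b : a <= b -> i a <= i b.
Proof. by move=> /meet_idPl ab; rewrite -ab (interior_meet int_i) leIr. Qed.

Lemma meet_closed_fixed_points F : proper_filter F ->
  meet_closed (F `&` fixed_points i)%classic.
Proof.
move=> pF; split=> [|a b [Fa ia] [Fb ib]].
  by split; [apply: pfilter_top | apply: interior_top].
split; first exact: pfilter_meet.
by rewrite /fixed_points /= (interior_meet int_i) ia ib.
Qed.

(** The monadic axiom [a <= i (dual_operator i a)] makes the open elements
    also closed. *)
Lemma fixed_points_compl a : (forall b, b <= i (dual_operator i b)) ->
  fixed_points i a -> fixed_points i (~` a).
Proof.
move=> i5 ia; apply/le_anti; rewrite (interior_le int_i) /=.
by apply: le_trans (i5 _) _; rewrite /dual_operator complK ia.
Qed.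

End InteriorOperators.

(** * Complex algebras *)

Section ComplexAlgebra.
Local Open Scope classical_set_scope.
Implicit Types (X : Type).

Lemma setC_rel_preimageP X (S : X -> X -> Prop) (U : set X) x :
  (~` rel_preimage S (~` U)) x <-> forall y, S x y -> U y.
Proof.
split=> [nx y Sxy|xU [y nUy /xU]//].
by apply: contrapT => nUy; apply: nx; exists y.
Qed.

Lemma setC_rel_imageP X (S : X -> X -> Prop) (U : set X) x :
  (~` rel_image S (~` U)) x <-> forall y, S y x -> U y.
Proof. exact: (setC_rel_preimageP (fun a b => S b a)). Qed.

Lemma interior_rel_preimage X (S : X -> X -> Prop) : PreOrder S ->
  interior_operator (fun U : set X => ~` rel_preimage S (~` U)).
Proof.
move=> [Sxx Strans]; split.
- move=> U V; apply/seteqP; split=> x.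
    move=> /setC_rel_preimageP xUV.
    by split; apply/setC_rel_preimageP => y /xUV [].
  move=> [/setC_rel_preimageP xU /setC_rel_preimageP xV].
  by apply/setC_rel_preimageP => y Sxy; split; [exact: xU | exact: xV].
- by apply/seteqP; split=> x // _; apply/setC_rel_preimageP.
- by move=> U; apply/subsetPset => x /setC_rel_preimageP; apply.
- move=> U; apply/subsetPset => x /setC_rel_preimageP xU.
  apply/setC_rel_preimageP => y Sxy; apply/setC_rel_preimageP => z Syz.
  by apply: xU; apply: Strans Syz.
Qed.

Lemma interior_rel_image X (S : X -> X -> Prop) : PreOrder S ->
  interior_operator (fun U : set X => ~` rel_image S (~` U)).
Proof.
move=> [Sxx Strans]; apply: (@interior_rel_preimage _ (fun a b => S b a)).
by split=> // x y z Syx Szy; apply: Strans Szy Syx.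
Qed.

(** Box along the converse of [S] after diamond along [S] is inflationary, for
    any relation [S]. *)
Lemma sub_rel_image_dual X (S : X -> X -> Prop) (U : set X) :
  U `<=` ~` rel_image S (~` ~` ~` rel_preimage S (~` ~` U)).
Proof.
move=> x Ux; apply/setC_rel_imageP => y Syx /setC_rel_preimageP nU.
exact: nU Syx Ux.
Qed.

Lemma sub_rel_preimage_dual X (S : X -> X -> Prop) (U : set X) :
  U `<=` ~` rel_preimage S (~` ~` ~` rel_image S (~` ~` U)).
Proof. exact: (@sub_rel_image_dual _ (fun a b => S b a)). Qed.

Lemma sub_symmetric_dual X (S : X -> X -> Prop) (U : set X) :
    (forall x y, S x y -> S y x) ->
  U `<=` ~` rel_image S (~` ~` ~` rel_image S (~` ~` U)).
Proof.
move=> Ssym x Ux; apply/setC_rel_imageP => y /Ssym Sxy /setC_rel_imageP nU.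
exact: nU Sxy Ux.
Qed.

(** The hypothesis gives [boxF_univ_op_le]: a world [z] reached from [x] by [E] then
    [R] is [E]-equivalent to an [R]-successor of [x]. *)
Lemma complex_algebra_MS4t (F : frame) :
    (forall x y z : F, accE x y -> accR y z -> exists2 w, accR x w & accE w z) ->
  MS4t_algebra (complex_algebra F).
Proof.
move=> confl.
have preR := accR_preorder F; have [Exx Esym Etrans] := accE_equivalence F.
split.
- exact: interior_rel_preimage.
- exact: interior_rel_image.
- exact: interior_rel_image.
- by move=> U; apply/subsetPset; apply: sub_rel_image_dual.
- by move=> U; apply/subsetPset; apply: sub_rel_preimage_dual.
- move=> U; apply/subsetPset; apply: sub_symmetric_dual => x y; exact: Esym.
- move=> U; apply/subsetPset => x /setC_rel_preimageP xU.
  apply/setC_rel_imageP => y /Esym Exy; apply/setC_rel_preimageP => z Ryz.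
  have [w Rxw Ewz] := confl _ _ _ Exy Ryz.
  by have /setC_rel_imageP := xU w Rxw; apply; apply: Esym.
Qed.

End ComplexAlgebra.

(** * The canonical frame *)

Section CanonicalFrame.
Context (B : trimodal_algebra) (hB : MS4t_algebra B).

(** By maximality, inclusion between traces on [B_0] is equality. *)
Lemma canonical_E_sub (x y : ultrafilters B) :
  (sval x `&` fixed_points univ_op `<=` sval y)%classic -> canonical_E x y.
Proof.
move=> xy; apply/seteqP; split=> a [xa fa]; split=> //; first exact: xy.
have [//|xna] := ultrafilter_compl a (svalP x).
have [] := ultrafilter_not_compl (svalP y) xa.
apply: xy; split=> //; apply: fixed_points_compl => //.
  exact: univ_interior.
exact: le_univ_exist.
Qed.

(** The frame condition dual to [boxF_univ_op_le]. *)
Lemma canonical_confluence (x y z : ultrafilters B) :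
    canonical_E x y -> canonical_R y z ->
  exists2 w, canonical_R x w & canonical_E w z.
Proof.
move=> Exy Ryz.
have iF := boxF_interior hB; have iU := univ_interior hB.
have px := ultra_filter (svalP x); have py := ultra_filter (svalP y).
have pz := ultra_filter (svalP z).
have mx := meet_closed_fixed_points iF px.
have mz := meet_closed_fixed_points iU pz.
have [|w uw subw] := ultrafilter_extension (proper_filter_join mx mz _).
  move=> a b [xa fa] [zb fb] /eqP; rewrite disj_leC => anb.
  have fnb : univ_op (~` b)%O = (~` b)%O.
    exact: fixed_points_compl iU _ (le_univ_exist hB) fb.
  have xnb : sval x (univ_op (boxF (~` b)%O)).
    apply: pfilter_up xa => //; apply: le_trans (boxF_univ_op_le hB _).
    by rewrite -fa fnb; apply: interior_mono.
  have [ynb _] : (sval y `&` fixed_points univ_op)%classic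
      (univ_op (boxF (~` b)%O)).
    by rewrite -Exy; split=> //; apply: interior_idem.
  have znb : sval z (boxF (~` b)%O).
    apply: Ryz; split; last exact: interior_idem.
    exact: pfilter_up (interior_le iU _) ynb.
  apply: (ultrafilter_not_compl (svalP z) zb).
  exact: pfilter_up (interior_le iF _) znb.
exists (exist _ w uw).
- by move=> a xa; apply: subw; apply: sub_filter_joinl.
- apply: esym; apply: canonical_E_sub => b zb.
  by apply: subw; apply: sub_filter_joinr.
Qed.

End CanonicalFrame.

Theorem corollary4p9 (B : trimodal_algebra) (hB : MS4t_algebra B) :
  MS4t_algebra (complex_algebra (canonical_frame B)).
Proof. exact/complex_algebra_MS4t/canonical_confluence. Qed.
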